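(* For any integer $n\geq 2$, $W_{c}\left(Q_{n}\right)\geq 4(n-1)$.
   Context: $Q_{n}$ is the $n$-dimensional hypercube graph, with vertex set $\{0,1\}^{n}$, two vertices being adjacent if and only if they differ in exactly one coordinate. For a finite simple graph $G$ and a positive integer $t$, an interval cyclic $t$-coloring of $G$ is a proper edge-coloring of $G$ with colors $1,\ldots,t$ such that all $t$ colors are used and, for each vertex $v$, the edges incident to $v$ are colored by $d_{G}(v)$ consecutive colors modulo $t$ (i.e. consecutive in the cyclic order $1,2,\ldots,t,1$), where $d_G(v)$ is the degree of $v$. For a graph $G$ having an interval cyclic $t$-coloring for some positive integer $t$, $W_{c}(G)$ is the greatest such $t$. (Every hypercube $Q_n$, $n\ge 1$, has such a coloring.) *)

(* Defs.v *)
From mathcomp Require Import all_boot.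

Set Implicit Arguments.
Unset Strict Implicit.
Unset Printing Implicit Defensive.

Record sgraph := SGraph {
  vertex :> finType;
  adj : rel vertex;
  adj_sym : symmetric adj;
  adj_irrefl : irreflexive adj }.

Section Graph.
Variable G : sgraph.

Definition edges : {set {set G}} :=
  [set [set xy.1; xy.2] | xy : G * G & adj xy.1 xy.2].

Definition incident (v : G) : {set {set G}} := [set e in edges | v \in e].

Definition degree (v : G) : nat := #|incident v|.

(* A colouring with colours 1, ..., t is a function c on all sets of vertices,  *)
(* of which only the values on edges matter; the extra value 0 : 'I_t.+1 is     *)
(* excluded on edges.                                                           *)
Definition proper_edge_coloring (t : nat) (c : {ffun {set G} -> 'I_t.+1}) :=
  [forall e in edges, 0 < c e] &&
  [forall e in edges, forall f in edges,
     (e != f) && (e :&: f != set0) ==> (c e != c f)].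

(* i is one of the d cyclically consecutive colours k.+1, k.+2, ... taken in    *)
(* the cyclic order 1, 2, ..., t, 1.                                            *)
Definition cyclic_interval (t k d i : nat) : bool :=
  [exists j : 'I_d, i == ((k + j) %% t).+1].

Definition interval_cyclic_coloring (t : nat) (c : {ffun {set G} -> 'I_t.+1}) :=
  [&& proper_edge_coloring c,
      [forall i : 'I_t.+1, (0 < i) ==> [exists e in edges, c e == i]]
    & [forall v, exists k : 'I_t, forall i : 'I_t.+1,
         [exists e in incident v, c e == i]
           == cyclic_interval t k (degree v) i]].

Definition interval_cyclic_colorable (t : nat) : bool :=
  (0 < t) && [exists c : {ffun {set G} -> 'I_t.+1}, interval_cyclic_coloring c].

(* The range of t is bounded because all t colours are used; see WcP. When G    *)
(* has no interval cyclic colouring, Wc takes the value 0.                      *)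
Definition Wc : nat :=
  \max_(t < #|edges|.+1 | interval_cyclic_colorable t) t.

Lemma interval_cyclic_colorable_le t :
  interval_cyclic_colorable t -> t <= #|edges|.
Proof.
case/andP=> _ /existsP[c /and3P[_ /forallP used _]].
have sub : [set i : 'I_t.+1 | 0 < i] \subset [set c e | e in edges].
  apply/subsetP=> i; rewrite inE => i_gt0.
  have /existsP[e /andP[eE /eqP <-]] := implyP (used i) i_gt0.
  exact: imset_f.
apply: leq_trans (leq_imset_card c edges); apply: leq_trans (subset_leq_card sub).
have -> : [set i : 'I_t.+1 | 0 < i] = ~: [set ord0].
  by apply/setP=> i; rewrite !inE -val_eqE /= lt0n.
by rewrite cardsC1 card_ord.
Qed.

Lemma Wc_ge t : interval_cyclic_colorable t -> t <= Wc.
Proof.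
move=> ct; have lt := interval_cyclic_colorable_le ct; rewrite -ltnS in lt.
exact: (@leq_bigmax_cond _ (fun i : 'I_#|edges|.+1 =>
  interval_cyclic_colorable i) (fun i => i : nat) (Ordinal lt)).
Qed.

Lemma WcP t : interval_cyclic_colorable t ->
  interval_cyclic_colorable Wc /\
  forall s, interval_cyclic_colorable s -> s <= Wc.
Proof.
move=> ct; split; last exact: Wc_ge.
have lt := interval_cyclic_colorable_le ct; rewrite -ltnS in lt.
by rewrite /Wc (bigmax_eq_arg (Ordinal lt)) //; case: arg_maxnP.
Qed.

End Graph.

Section Hypercube.
Variable n : nat.

Definition cube_adj (x y : {ffun 'I_n -> bool}) : bool :=
  #|[set i | x i != y i]| == 1.

Lemma cube_adj_sym : symmetric cube_adj.
Proof.
move=> x y; rewrite /cube_adj; congr (_ == 1).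
by apply: eq_card => i; rewrite !inE eq_sym.
Qed.

Lemma cube_adj_irrefl : irreflexive cube_adj.
Proof.
move=> x; rewrite /cube_adj (_ : [set i | _] = set0) ?cards0 //.
by apply/setP=> i; rewrite !inE eqxx.
Qed.

Definition hypercube : sgraph := SGraph cube_adj_sym cube_adj_irrefl.

End Hypercube.

(* Main.v *)
Require Import Defs.
From mathcomp Require Import all_boot.
From mathcomp Require Import perm zify.

Set Implicit Arguments.
Unset Strict Implicit.
Unset Printing Implicit Defensive.

(** Write [n = m.+1] and view [Q_n] as the product of the 4-cycle [Q_2],
    spanned by the first and the last coordinates, with [Q_(n-2)]. Number the
    four copies of [Q_(n-2)] by [q = 0, 1, 2, 3] along the 4-cycle. With
    colours taken modulo [4 * m], an edge of copy [q] in the direction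
    [0 < i < m] gets the colour [q * m + i], and all the edges between copy [q]
    and copy [q + 1] get the colour [(q + 1) * m]. A vertex of copy [q] then
    sees exactly the [n] consecutive colours [q * m, ..., q * m + m]: the two
    ends come from the two neighbouring copies and the others from inside the
    copy. As [q] varies these intervals cover all the residues modulo [4 * m],
    so this is an interval cyclic colouring with [4 * m = 4 * (n - 1)] colours.

    The main points of the proof are that the colour of an edge does not depend
    on the endpoint used to compute it ([dir_color_flip]), and that the colours
    at a vertex of copy [q] are [q * m] plus a permutation of [0, ..., m]
    ([offset], an involution). *)

Section Edges.
Variable n : nat.
Implicit Types (x y v : hypercube n) (i j : 'I_n) (e : {set hypercube n}).

(** The neighbour of [x] in the direction [i]. *)
Definition flip x i : hypercube n := [ffun j => x j (+) (j == i)].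

(** The edge at [x] in the direction [i]. *)
Definition dir_edge x i : {set hypercube n} := [set x; flip x i].

Lemma flipK i : involutive (flip^~ i).
Proof. by move=> x; apply/ffunP=> j; rewrite !ffunE -addbA addbb addbF. Qed.

Lemma flip_inj x : injective (flip x).
Proof.
move=> i j /ffunP/(_ i); rewrite !ffunE eqxx => /addbI/esym.
by rewrite -/(is_true _) => /eqP.
Qed.

Lemma cube_adjP x y : reflect (exists i, y = flip x i) (adj x y).
Proof.
apply: (iffP cards1P) => [[i /setP xy]|[i ->]]; exists i.
  apply/ffunP=> j; rewrite ffunE; move: (xy j); rewrite !inE => <-.
  by case: (x j); case: (y j).
by apply/setP=> j; rewrite !inE ffunE; case: (x j); case: (j == i).
Qed.

Lemma flip_neq x i : flip x i != x.
Proof.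
by apply/eqP=> /ffunP/(_ i); rewrite ffunE eqxx; case: (x i).
Qed.

Lemma dir_edge_flip x i : dir_edge (flip x i) i = dir_edge x i.
Proof. by rewrite /dir_edge flipK setUC. Qed.

Lemma dir_edge_eq x y i j : dir_edge x i = dir_edge y j ->
  i = j /\ (x = y \/ x = flip y j).
Proof.
move=> /setP E.
have := E x; rewrite !inE eqxx /= => /esym/orP xyj.
have := E (flip x i); rewrite !inE eqxx orbT => /esym/orP fyj.
case: xyj => /eqP xE; case: fyj => /eqP fE.
- by move/eqP: fE; rewrite -xE (negPf (flip_neq _ _)).
- by split; [apply: (@flip_inj x); rewrite fE xE | left].
- by split; [apply: (@flip_inj x); rewrite fE xE flipK | right].
- by move/eqP: fE; rewrite -xE (negPf (flip_neq _ _)).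
Qed.

Lemma edgesP e : reflect (exists x i, e = dir_edge x i) (e \in edges (hypercube n)).
Proof.
apply: (iffP imsetP) => [[[x y]]|[x [i ->]]].
  by rewrite inE => /cube_adjP[i /= ->] ->; exists x, i.
by exists (x, flip x i); rewrite ?inE //; apply/cube_adjP; exists i.
Qed.

Lemma incidentE v : incident v = [set dir_edge v i | i : 'I_n].
Proof.
apply/setP=> e; rewrite inE; apply/andP/imsetP.
  case=> /edgesP[x [i ->]]; rewrite !inE => /orP[]/eqP->; exists i => //.
  by rewrite dir_edge_flip.
case=> i _ ->; split; last by rewrite !inE eqxx.
by apply/edgesP; exists v, i.
Qed.

Lemma degree_hypercube v : degree v = n.
Proof.
rewrite /degree incidentE card_imset ?card_ord // => i j.
by move=> /dir_edge_eq[].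
Qed.

End Edges.

Section Coloring.
Variable m : nat.
Hypothesis m_gt0 : 0 < m.
Implicit Types (x y v : hypercube m.+1) (i j : 'I_m.+1).

(** The copy of [Q_(n-2)] that contains [x]: the two distinguished coordinates
    of [x], read as a Gray code. *)
Definition quadrant x : nat :=
  if x ord0 then (if x ord_max then 2 else 3) else (if x ord_max then 1 else 0).

(** The rank of the edge in the direction [i] among the edges at [x]. Changing
    the last coordinate leads to the next copy when the two distinguished
    coordinates of [x] agree, and to the previous one otherwise; the first
    coordinate behaves in the opposite way. *)
Definition offset x i : 'I_m.+1 :=
  if x ord0 == x ord_max then i else tperm ord0 ord_max i.

(** The colour, counted from 0, of the edge at [x] in the direction [i]. *)
Definition dir_color x i : nat := (quadrant x * m + offset x i) %% (4 * m).

Lemma quadrant_lt x : quadrant x < 4.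
Proof. by rewrite /quadrant; case: (x ord0); case: (x ord_max). Qed.

Lemma quadrant_surj q : q < 4 -> exists x, quadrant x = q.
Proof.
move=> q_lt4.
pose x : hypercube m.+1 := [ffun i : 'I_m.+1 =>
  if i == ord0 then 1 < q else (q == 1) || (q == 2)].
exists x; rewrite /quadrant !ffunE eqxx.
have -> : (ord_max == ord0 :> 'I_m.+1) = false by rewrite -val_eqE /=; lia.
by case: q q_lt4 {x} => [|[|[|[|]]]].
Qed.

Lemma offsetK x : involutive (offset x).
Proof. by move=> i; rewrite /offset; case: eqP => // _; rewrite tpermK. Qed.

Lemma dir_color_lt x i : dir_color x i < 4 * m.
Proof. by rewrite ltn_mod muln_gt0. Qed.

Lemma dir_color_inj x : injective (dir_color x).
Proof.
move=> i j /eqP; rewrite eqn_modDl.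
have offset_lt k : offset x k < 4 * m by have := ltn_ord (offset x k); lia.
rewrite !modn_small //.
by move=> /eqP/val_inj/(can_inj (offsetK x)).
Qed.

Lemma dir_color_flip x i : dir_color (flip x i) i = dir_color x i.
Proof.
have max0 : (ord_max == ord0 :> 'I_m.+1) = false by rewrite -val_eqE /=; lia.
rewrite /dir_color /quadrant /offset !ffunE !(eq_sym _ i).
have [->|i0] := eqVneq i ord0; last have [->|im] := eqVneq i ord_max.
- rewrite eq_sym max0 tpermL /=.
  (* Between copies 0 and 3 the two expressions differ by a full turn. *)
  by case: (x ord0); case: (x ord_max) => /=; rewrite -?(modnDr (0 * m + 0));
     congr (_ %% _); lia.
- rewrite tpermR /=.
  by case: (x ord0); case: (x ord_max) => /=; congr (_ %% _); lia.
- by rewrite !addbF.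
Qed.

(** The edge colouring induced by [dir_color], with colours counted from 1;
    sets of vertices that are not edges get the colour 0. *)
Definition cube_coloring : {ffun {set hypercube m.+1} -> 'I_(4 * m).+1} :=
  [ffun e => if [pick p : hypercube m.+1 * 'I_m.+1 | e == dir_edge p.1 p.2]
             is Some p then inord (dir_color p.1 p.2).+1 else ord0].

Lemma cube_coloringE x i : cube_coloring (dir_edge x i) = (dir_color x i).+1 :> nat.
Proof.
rewrite ffunE; case: pickP => [[y j] /= /eqP /dir_edge_eq[<- xy]|/(_ (x, i))].
  rewrite inordK ?ltnS ?dir_color_lt //.
  by case: xy => ->; rewrite ?dir_color_flip.
by rewrite eqxx.
Qed.

Lemma cube_coloring_proper : proper_edge_coloring cube_coloring.
Proof.
apply/andP; split.
  by apply/forall_inP=> e /edgesP[x [i ->]]; rewrite cube_coloringE.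
apply/forall_inP=> e eE; apply/forall_inP=> f fE.
apply/implyP=> /andP[ef /set0Pn[v]]; rewrite inE => /andP[ve vf].
have /imsetP[i _ ei] : e \in [set dir_edge v i | i : 'I_m.+1].
  by rewrite -incidentE inE eE.
have /imsetP[j _ fj] : f \in [set dir_edge v i | i : 'I_m.+1].
  by rewrite -incidentE inE fE.
apply: contraNneq ef => /(congr1 val) /=.
by rewrite ei fj !cube_coloringE => -[/dir_color_inj ->].
Qed.

Lemma cube_coloring_interval_cyclic : interval_cyclic_coloring cube_coloring.
Proof.
apply/and3P; split; first exact: cube_coloring_proper.
  apply/forallP=> -[[|k] //= kS_lt]; have k_lt : k < 4 * m by [].
  have [x qx] : exists x, quadrant x = k %/ m.
    by apply: quadrant_surj; rewrite ltn_divLR.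
  have r_lt : k %% m < m.+1 by rewrite ltnS ltnW // ltn_mod.
  pose i := offset x (Ordinal r_lt).
  apply/exists_inP; exists (dir_edge x i); first by apply/edgesP; exists x, i.
  by rewrite -val_eqE /= cube_coloringE /dir_color offsetK qx -divn_eq modn_small.
apply/forallP=> v.
have k_lt : quadrant v * m < 4 * m by rewrite ltn_pmul2r ?quadrant_lt.
apply/existsP; exists (Ordinal k_lt); apply/forallP=> k.
rewrite degree_hypercube incidentE; apply/eqP.
apply/exists_inP/existsP => [[e /imsetP[i _ ->] /eqP <-]|[j /eqP kE]].
  by exists (offset v i); rewrite cube_coloringE.
exists (dir_edge v (offset v j)); first exact: imset_f.
by rewrite -val_eqE /= cube_coloringE kE /dir_color offsetK.
Qed.

End Coloring.

Theorem theorem33 (n : nat) (hn : 2 <= n) : 4 * (n - 1) <= Wc (hypercube n).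
Proof.
case: n hn => [|m] //; rewrite ltnS => m_gt0; rewrite subSS subn0.
apply: Wc_ge; apply/andP; split; first by rewrite muln_gt0.
by apply/existsP; exists (cube_coloring m); apply: cube_coloring_interval_cyclic.
Qed.
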